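(* Let $R=\mathbb{C}[x,y,z]$ and, for positive integers $r,d$, let $\operatorname{Quot}_r^d\mathbb{A}^3$ be the Quot scheme parametrising quotients $R^{\oplus r}\twoheadrightarrow M$ with $\dim_{\mathbb{C}} M=d$ (equivalently, submodules $K\subset R^{\oplus r}$ with $\dim_{\mathbb{C}}R^{\oplus r}/K=d$). Suppose that either $r=1$ and $d\geqslant 12$, or $r\geqslant 2$ and $d\geqslant 8$. Then there exists a point $[0\to K\to R^{\oplus r}\to M\to 0]\in\operatorname{Quot}_r^d\mathbb{A}^3$ such that \[ \dim_{\mathbb{C}}\mathsf T_{[M]}\operatorname{Quot}_r^d\mathbb{A}^3=\dim_{\mathbb{C}}\operatorname{Hom}_R(K,M)\not\equiv r\cdot d \pmod 2. \] In particular, the parity conjecture (which asserts that for every irreducible smooth threefold $X$ and every $[\mathcal F]\in\operatorname{Quot}_r^dX$ one has $\dim_{\mathbb{C}}\mathsf T_{[\mathcal F]}\operatorname{Quot}_r^dX\equiv r d\pmod 2$) is false for all such $(r,d)$.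
   Context: The tangent space to the Quot scheme at a point $[0\to K\to R^{\oplus r}\to M\to 0]$ is identified with $\operatorname{Hom}_R(K,M)$. Everything is over $\mathbb{C}$. *)

(* Defs.v *)
From HB Require Import structures.
From mathcomp Require Import all_boot all_order all_algebra.
From mathcomp Require Import mpoly.
From mathcomp Require Import complex.
From mathcomp Require Import Rstruct.
Set Implicit Arguments. Unset Strict Implicit. Unset Printing Implicit Defensive.
Import GRing.Theory.
Local Open Scope ring_scope.

Definition CC : numClosedFieldType := (Rdefinitions.R)[i].

Notation Rxyz := {mpoly CC[3]}.

Notation Free r := 'rV[Rxyz]_r.

Definition is_submodule (r : nat) (K : Free r -> Prop) : Prop :=
  [/\ K 0,
      (forall u v, K u -> K v -> K (u + v)) &
      (forall (p : Rxyz) u, K u -> K (p *: u))].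

Definition quot_dim (r : nat) (K : Free r -> Prop) (d : nat) : Prop :=
  exists v : 'I_d -> Free r,
    forall f : Free r,
      exists c : {ffun 'I_d -> CC},
        K (f - \sum_(i < d) (c i)%:MP *: v i) /\
        forall c' : {ffun 'I_d -> CC},
          K (f - \sum_(i < d) (c' i)%:MP *: v i) -> c' = c.

(* phi : V -> V represents (through its values on K, taken modulo K) a map
   K -> M = R^{\oplus r}/K; it is R-linear. *)
Definition is_hom (r : nat) (K : Free r -> Prop) (phi : Free r -> Free r) : Prop :=
  (forall k k', K k -> K k' -> K (phi (k + k') - (phi k + phi k'))) /\
  (forall (p : Rxyz) k, K k -> K (phi (p *: k) - p *: phi k)).

(* dim_C Hom_R(K, R^{\oplus r}/K) = n: there are n homomorphisms forming a
   C-basis, two representatives being identified when they agree on K modulo K. *)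
Definition hom_dim (r : nat) (K : Free r -> Prop) (n : nat) : Prop :=
  exists b : 'I_n -> (Free r -> Free r),
    (forall i, is_hom K (b i)) /\
    forall phi, is_hom K phi ->
      exists c : {ffun 'I_n -> CC},
        (forall k, K k -> K (phi k - \sum_(i < n) (c i)%:MP *: b i k)) /\
        forall c' : {ffun 'I_n -> CC},
          (forall k, K k -> K (phi k - \sum_(i < n) (c' i)%:MP *: b i k)) -> c' = c.

(* Main.v *)
(** A finite-dimensional quotient of [R^r] is a space [V] with commuting
    matrices [A_k] and [r] vectors generating it; [K] is the kernel of the
    evaluation map [R^r -> V].  A homomorphism [K -> V] is the restriction of
    the derivative at [eps = 0] of the evaluation map for a deformation
    [A_k + eps A'_k] over the dual numbers, and it comes from exactly one
    deformation whose derivative vanishes on a chosen monomial basis of [V].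
    So [Hom_R(K, V)] is the solution space of an explicit integral linear
    system, whose rank is found by elimination.

    The two basic points have tangent dimensions 45 for [(r, d) = (1, 12)] and
    39 for [(r, d) = (2, 8)].  Adding a free summand to [K] raises the tangent
    dimension by [d], and adding a reduced point away from the support (Chinese
    remainder theorem) raises it by [r + 2]; both changes preserve the defect of
    parity, which gives all other [(r, d)]. *)

Require Import Defs.
From mathcomp Require Import all_boot all_order all_algebra mpoly ssrcomplements.
Set Implicit Arguments. Unset Strict Implicit. Unset Printing Implicit Defensive.
Import GRing.Theory Num.Theory.
Local Open Scope ring_scope.

(** * Polynomials acting through commuting operators *)

Lemma linear_fun0 (R : nzRingType) (U V : lmodType R) (f : U -> V) :
  linear f -> f 0 = 0.
Proof. by move=> /(_ (-1) 0 0); rewrite !scaleN1r !addNr. Qed.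

Lemma linear_funD (R : nzRingType) (U V : lmodType R) (f : U -> V) :
  linear f -> {morph f : x y / x + y}.
Proof. by move=> lf x y; have := lf 1 x y; rewrite !scale1r. Qed.

Section PolynomialAction.
Context (R : fieldType) (n : nat) (V : lmodType R) (T : 'I_n -> V -> V).
Hypothesis linT : forall i, linear (T i).
Hypothesis commT : forall i j v, T i (T j v) = T j (T i v).
Implicit Types (m : 'X_{1..n}) (p q : {mpoly R[n]}) (u v : V).

(** The list of variables is a parameter so that facts about [monom_act] can be proved by induction
    on it. *)
Definition monom_act_on (s : seq 'I_n) m v :=
  foldr (fun i w => iter (m i) (T i) w) v s.
Definition monom_act := monom_act_on (enum 'I_n).
Definition poly_act p v := \sum_(m <- msupp p) p@_m *: monom_act m v.

Lemma iter_linear i k : linear (iter k (T i)).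
Proof. by elim: k => //= k IHk a u v /=; rewrite IHk linT. Qed.

Lemma monom_act_linear m : linear (monom_act m).
Proof.
rewrite /monom_act; elim: (enum 'I_n) => //= i s IHs a u v.
by rewrite /= IHs iter_linear.
Qed.

Lemma iter_comm i j k l v :
  iter k (T i) (iter l (T j) v) = iter l (T j) (iter k (T i) v).
Proof.
elim: k => //= k ->; elim: l => //= l IHl.
by rewrite commT IHl.
Qed.

Lemma monom_act_iter s m k i v :
  monom_act_on s m (iter k (T i) v) = iter k (T i) (monom_act_on s m v).
Proof. by elim: s => //= j s ->; rewrite iter_comm. Qed.

Lemma monom_actD m1 m2 v :
  monom_act (m1 + m2) v = monom_act m1 (monom_act m2 v).
Proof.
rewrite /monom_act; elim: (enum 'I_n) => //= i s ->.
by rewrite mnmDE iterD monom_act_iter.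
Qed.

Lemma monom_actU i v : monom_act U_(i) v = T i v.
Proof.
rewrite /monom_act.
suff H s : uniq s -> monom_act_on s U_(i) v = if i \in s then T i v else v.
  by rewrite H ?enum_uniq // mem_enum.
elim: s => //= j s IHs /andP[js us]; rewrite IHs // in_cons mnm1E.
by case: eqVneq js => [->|_] /= js; rewrite ?(negPf js).
Qed.

(** Supports vary with the polynomial. Summing over all monomials of bounded degree gives several
    polynomials a common index set, so that linearity in [p] can be checked term by term. *)
Lemma poly_actE k p v : (msize p <= k)%N ->
  poly_act p v = \sum_(m : 'X_{1..n < k}) p@_m *: monom_act m v.
Proof.
move=> le_pk; set I : subFinType _ := 'X_{1..n < k}.
rewrite /poly_act (big_mksub I) ?msupp_uniq //=; first last.
  by move=> x /msize_mdeg_lt /leq_trans; apply.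
by rewrite big_rmcond //= => j /memN_msupp_eq0 ->; rewrite scale0r.
Qed.

Lemma poly_act_linearl a p q v :
  poly_act (a *: p + q) v = a *: poly_act p v + poly_act q v.
Proof.
pose k := maxn (msize (a *: p + q)) (maxn (msize p) (msize q)).
rewrite !(@poly_actE k) ?leq_max ?leqnn ?orbT // scaler_sumr -big_split.
by apply: eq_bigr => m _; rewrite mcoeffD mcoeffZ scalerDl scalerA.
Qed.

Lemma poly_actDl p q v : poly_act (p + q) v = poly_act p v + poly_act q v.
Proof. by rewrite -[p in LHS]scale1r poly_act_linearl scale1r. Qed.

Lemma poly_act0 v : poly_act 0 v = 0.
Proof. by rewrite /poly_act msupp0 big_nil. Qed.

Lemma poly_act_linear p : linear (poly_act p).
Proof.
move=> a u v; rewrite /poly_act scaler_sumr -big_split.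
by apply: eq_bigr => m _; rewrite monom_act_linear scalerDr !scalerA mulrC.
Qed.

Lemma poly_actXm m v : poly_act 'X_[m] v = monom_act m v.
Proof. by rewrite /poly_act msuppX big_seq1 mcoeffX eqxx scale1r. Qed.

Lemma poly_actX i v : poly_act 'X_i v = T i v.
Proof. by rewrite poly_actXm monom_actU. Qed.

Lemma poly_act1 v : poly_act 1 v = v.
Proof.
rewrite -(mpolyX0 n R) poly_actXm /monom_act.
by elim: (enum 'I_n) => //= i s ->; rewrite mnm0E.
Qed.

Lemma poly_actC c v : poly_act c%:MP v = c *: v.
Proof.
by rewrite -[c%:MP]addr0 -alg_mpolyC poly_act_linearl poly_act1 poly_act0 addr0.
Qed.

Section Equivariance.
Context (U : lmodType {mpoly R[n]}) (G : U -> V).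
Hypothesis G_add : {morph G : x y / x + y}.
Hypothesis G_scale : forall c x, G (c%:MP *: x) = c *: G x.
Hypothesis G_var : forall i x, G ('X_i *: x) = T i (G x).

(** Constants and variables generate the polynomial ring, so compatibility with them is enough. The
    source [U] is any module: below it is either a free module or the ring itself. *)
Lemma equivariant_poly_act p x : G (p *: x) = poly_act p (G x).
Proof.
elim/mpolyind: p => [|c m p _ _ IHp].
  by rewrite poly_act0 -mpolyC0 G_scale scale0r.
rewrite scalerDl G_add IHp poly_act_linearl; congr (_ + _).
rewrite -mul_mpolyC -scalerA G_scale poly_actXm; congr (_ *: _).
(* The monomial is written as a product over the same enumeration of variables that [monom_act]
   folds over, so both sides unroll together. *)
rewrite mpolyXE_id -big_enum /monom_act.
elim: (enum 'I_n) => [|i s IHs]; first by rewrite big_nil scale1r.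
rewrite big_cons -scalerA /= -IHs.
elim: (m i) => [|k IHk]; first by rewrite scale1r.
by rewrite exprS -scalerA G_var IHk.
Qed.
End Equivariance.

Lemma poly_actM p q v : poly_act (p * q) v = poly_act p (poly_act q v).
Proof.
elim/mpolyind: p => [|c m p _ _ IHp]; first by rewrite mul0r !poly_act0.
rewrite mulrDl -scalerAl !poly_act_linearl IHp; congr (_ *: _ + _).
elim/mpolyind: q {IHp} => [|b m' q _ _ IHq].
  by rewrite mulr0 !poly_act0 (linear_fun0 (poly_act_linear _)).
rewrite mulrDr -scalerAr -mpolyXD !poly_act_linearl IHq poly_act_linear.
by rewrite !poly_actXm monom_actD.
Qed.

(** * Evaluation of a free module at chosen generators *)

Section Evaluation.
Context (r : nat) (e : 'I_r -> V).

Definition gen_eval (f : 'rV[{mpoly R[n]}]_r) := \sum_j poly_act (f 0 j) (e j).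

Lemma gen_evalZ p f : gen_eval (p *: f) = poly_act p (gen_eval f).
Proof.
have lp := poly_act_linear p.
rewrite (big_morph _ (linear_funD lp) (linear_fun0 lp)).
by apply: eq_bigr => j _; rewrite mxE poly_actM.
Qed.

Lemma gen_evalD : {morph gen_eval : f g / f + g}.
Proof.
move=> f g; rewrite /gen_eval -big_split; apply: eq_bigr => j _.
by rewrite mxE poly_actDl.
Qed.

Lemma gen_evalC c f : gen_eval (c%:MP *: f) = c *: gen_eval f.
Proof. by rewrite gen_evalZ poly_actC. Qed.

Lemma gen_eval0 : gen_eval 0 = 0.
Proof. by rewrite -(scale0r 0) -mpolyC0 gen_evalC scale0r. Qed.

Lemma gen_evalB : {morph gen_eval : f g / f - g}.
Proof.
move=> f g; have ->: - g = (-1)%:MP *: g by rewrite mpolyCN mpolyC1 scaleN1r.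
by rewrite gen_evalD gen_evalC scaleN1r.
Qed.

Lemma gen_eval_sum (I : Type) (s : seq I) (c : I -> R) (f : I -> 'rV_r) :
  gen_eval (\sum_(i <- s) (c i)%:MP *: f i) = \sum_(i <- s) c i *: gen_eval (f i).
Proof.
by rewrite (big_morph _ gen_evalD gen_eval0); under eq_bigr do rewrite gen_evalC.
Qed.

Lemma gen_evalX i f : gen_eval ('X_i *: f) = T i (gen_eval f).
Proof. by rewrite gen_evalZ poly_actX. Qed.

Lemma gen_eval_delta j : gen_eval (delta_mx 0 j) = e j.
Proof.
rewrite /gen_eval (bigD1 j) //= mxE !eqxx poly_act1 big1 ?addr0 // => k kj.
by rewrite mxE eqxx (negPf kj) poly_act0.
Qed.

(** The universal property of the free module, in a form that asks for compatibility with constants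
    and variables only. *)
Lemma gen_eval_unique (G : 'rV[{mpoly R[n]}]_r -> V) :
  {morph G : x y / x + y} -> (forall c x, G (c%:MP *: x) = c *: G x) ->
  (forall i x, G ('X_i *: x) = T i (G x)) ->
  (forall j, G (delta_mx 0 j) = e j) -> G =1 gen_eval.
Proof.
move=> GD Gs GX Ge f; rewrite {1}[f]row_sum_delta (big_morph _ GD (id1 := 0)).
  by apply: eq_bigr => j _; rewrite (equivariant_poly_act GD Gs GX) Ge.
by rewrite -(scale0r 0) -mpolyC0 Gs scale0r.
Qed.

End Evaluation.
End PolynomialAction.

(** * Homomorphisms as deformations over the dual numbers *)

(* At [F = CC] and [n = 3] the next four predicates are convertible to
   [is_submodule], [quot_dim], [is_hom] and [hom_dim]. *)
Definition submodule_pred (F : fieldType) n (r : nat)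
    (K : 'rV[{mpoly F[n]}]_r -> Prop) : Prop :=
  [/\ K 0,
      (forall u v, K u -> K v -> K (u + v)) &
      (forall (p : {mpoly F[n]}) u, K u -> K (p *: u))].

Definition quot_dim_pred (F : fieldType) n (r : nat)
    (K : 'rV[{mpoly F[n]}]_r -> Prop) (d : nat) : Prop :=
  exists v : 'I_d -> 'rV[{mpoly F[n]}]_r,
    forall f,
      exists c : {ffun 'I_d -> F},
        K (f - \sum_(i < d) (c i)%:MP *: v i) /\
        forall c' : {ffun 'I_d -> F},
          K (f - \sum_(i < d) (c' i)%:MP *: v i) -> c' = c.

Definition hom_pred (F : fieldType) n (r : nat)
    (K : 'rV[{mpoly F[n]}]_r -> Prop) phi : Prop :=
  (forall k k', K k -> K k' -> K (phi (k + k') - (phi k + phi k'))) /\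
  (forall (p : {mpoly F[n]}) k, K k -> K (phi (p *: k) - p *: phi k)).

Definition hom_dim_pred (F : fieldType) m (r : nat)
    (K : 'rV[{mpoly F[m]}]_r -> Prop) (n : nat) : Prop :=
  exists b : 'I_n -> ('rV[{mpoly F[m]}]_r -> 'rV[{mpoly F[m]}]_r),
    (forall i, hom_pred K (b i)) /\
    forall phi, hom_pred K phi ->
      exists c : {ffun 'I_n -> F},
        (forall k, K k -> K (phi k - \sum_(i < n) (c i)%:MP *: b i k)) /\
        forall c' : {ffun 'I_n -> F},
          (forall k, K k -> K (phi k - \sum_(i < n) (c' i)%:MP *: b i k)) -> c' = c.

(** * Quotients presented by commuting matrices and lifts of a basis *)

Section Presentation.
Context (F : fieldType) (m d r : nat) (A : 'I_m -> 'M[F]_d) (e : 'I_r -> 'rV[F]_d).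
Context (b : 'I_d -> 'rV[{mpoly F[m]}]_r).
Hypothesis commA : forall k l, A k *m A l = A l *m A k.

Definition mx_act k (v : 'rV[F]_d) := v *m A k.
Definition mx_eval := gen_eval mx_act e.
Definition mx_ker (f : 'rV[{mpoly F[m]}]_r) : Prop := mx_eval f = 0.

Lemma mx_act_linear k : linear (mx_act k).
Proof. by move=> a u v; rewrite /mx_act mulmxDl scalemxAl. Qed.

Lemma mx_act_comm k l v : mx_act k (mx_act l v) = mx_act l (mx_act k v).
Proof. by rewrite /mx_act -!mulmxA commA. Qed.

Let evD := gen_evalD mx_act e.
Let evB := gen_evalB mx_act_linear mx_act_comm e.
Let evZ := gen_evalZ mx_act_linear mx_act_comm e.
Let evC := gen_evalC mx_act_linear mx_act_comm e.
Let evX := gen_evalX mx_act_linear mx_act_comm e.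
Let ev_sum := gen_eval_sum mx_act_linear mx_act_comm e.
Let ev0 := gen_eval0 mx_act_linear mx_act_comm e.

Lemma mx_ker_submodule : submodule_pred mx_ker.
Proof.
split=> [|u v|p u]; rewrite /mx_ker /mx_eval ?ev0 //.
  by rewrite evD => -> ->; rewrite addr0.
by rewrite evZ => ->; apply/linear_fun0/poly_act_linear/mx_act_linear.
Qed.

Hypothesis evb : forall i, mx_eval (b i) = delta_mx 0 i.

(** A linear section of the evaluation map. It turns maps into [V] into the representatives with
    values in the free module that [hom_pred] speaks of. *)
Definition lift_row (c : 'rV[F]_d) : 'rV[{mpoly F[m]}]_r := \sum_i (c 0 i)%:MP *: b i.

Lemma mx_eval_lift c : mx_eval (lift_row c) = c.
Proof.
rewrite /mx_eval ev_sum [RHS]row_sum_delta.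
by apply: eq_bigr => i _; rewrite -/mx_eval evb.
Qed.

Lemma lift_rowD : {morph lift_row : u v / u + v}.
Proof.
move=> u v; rewrite /lift_row -big_split; apply: eq_bigr => i _.
by rewrite mxE mpolyCD scalerDl.
Qed.

Lemma lift_rowZ a u : lift_row (a *: u) = a%:MP *: lift_row u.
Proof.
rewrite /lift_row scaler_sumr; apply: eq_bigr => i _.
by rewrite mxE mpolyCM scalerA.
Qed.

Lemma lift_row0 : lift_row 0 = 0.
Proof. by rewrite -(scale0r 0) lift_rowZ mpolyC0 scale0r. Qed.

Lemma lift_row_delta i : lift_row (delta_mx 0 i) = b i.
Proof.
rewrite /lift_row (bigD1 i) //= mxE !eqxx mpolyC1 scale1r.
rewrite big1 ?addr0 // => j ji.
by rewrite mxE eqxx (negPf ji) mpolyC0 scale0r.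
Qed.

Lemma mx_ker_proj f : mx_ker (f - lift_row (mx_eval f)).
Proof. by rewrite /mx_ker /mx_eval evB -/mx_eval mx_eval_lift subrr. Qed.

Lemma mx_ker_quot_dim : quot_dim_pred mx_ker d.
Proof.
exists b => f; exists [ffun i => mx_eval f 0 i].
have E c : mx_ker (f - \sum_(i < d) (c i)%:MP *: b i) <->
    mx_eval f = \row_i c i.
  rewrite /mx_ker /mx_eval evB ev_sum; split=> [/subr0_eq|] ->.
    by rewrite [RHS]row_sum_delta; apply: eq_bigr => i _; rewrite -/mx_eval evb mxE.
  apply/eqP; rewrite subr_eq0 [X in X == _]row_sum_delta; apply/eqP.
  by apply: eq_bigr => i _; rewrite -/mx_eval evb mxE.
split=> [|c /E fc]; first by apply/E/rowP => i; rewrite mxE ffunE.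
by apply/ffunP => i; rewrite ffunE fc mxE.
Qed.

(* The matrices [A + eps A'] over the dual numbers commute exactly when
   [lin_comm A'] holds; [def_act] is their action on [V + eps V]. *)
Definition lin_comm (A' : 'I_m -> 'M[F]_d) := forall k l,
  A k *m A' l + A' k *m A l = A l *m A' k + A' l *m A k.
Definition def_act (A' : 'I_m -> 'M[F]_d) k (v : 'rV[F]_d * 'rV[F]_d) :=
  (v.1 *m A k, v.2 *m A k + v.1 *m A' k).
(** The generators themselves stay undeformed, in accordance with the normalisation that the
    derivative vanishes on the basis lifts, among which the generators will be. *)
Definition def_eval A' := gen_eval (def_act A') (fun j => (e j, 0)).
Definition def_deriv A' f := (def_eval A' f).2.

Section Deformation.
Context (A' : 'I_m -> 'M[F]_d).

Lemma def_act_linear k : linear (def_act A' k).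
Proof.
move=> a u v; rewrite /def_act !mulmxDl -!scalemxAl; congr pair.
by rewrite [(a *: _).2]/= scalerDr addrACA.
Qed.

Hypothesis commA' : lin_comm A'.

Lemma def_act_comm k l v : def_act A' k (def_act A' l v) = def_act A' l (def_act A' k v).
Proof.
rewrite /def_act /= -!mulmxA commA; congr pair.
rewrite !mulmxDl -!mulmxA -!addrA -!mulmxDr.
have -> : A' l *m A k + A l *m A' k = A' k *m A l + A k *m A' l.
  by rewrite addrC -commA' addrC.
by rewrite [A l *m A k]commA.
Qed.

Lemma def_eval1 f : (def_eval A' f).1 = mx_eval f.
Proof.
apply: (gen_eval_unique (T := mx_act) (G := fun g => (def_eval A' g).1)).
- by move=> x y; rewrite /def_eval gen_evalD.
- by move=> c x; rewrite /def_eval (gen_evalC def_act_linear def_act_comm).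
- by move=> i x; rewrite /def_eval (gen_evalX def_act_linear def_act_comm).
- by move=> j; rewrite /def_eval gen_eval_delta.
Qed.

Lemma def_derivD : {morph def_deriv A' : f g / f + g}.
Proof. by move=> f g; rewrite /def_deriv /def_eval gen_evalD. Qed.

Lemma def_derivC c f : def_deriv A' (c%:MP *: f) = c *: def_deriv A' f.
Proof. by rewrite /def_deriv /def_eval (gen_evalC def_act_linear def_act_comm). Qed.

Lemma def_derivX k f :
  def_deriv A' ('X_k *: f) = def_deriv A' f *m A k + mx_eval f *m A' k.
Proof.
by rewrite -def_eval1 /def_deriv /def_eval (gen_evalX def_act_linear def_act_comm).
Qed.

Lemma def_deriv_delta j : def_deriv A' (delta_mx 0 j) = 0.
Proof. by rewrite /def_deriv /def_eval gen_eval_delta. Qed.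

(** The pair of [mx_eval] and [G] obeys the rules of evaluation over the dual numbers, so the
    universal property identifies it with [def_eval]. *)
Lemma def_deriv_unique (G : 'rV[{mpoly F[m]}]_r -> 'rV[F]_d) :
  {morph G : x y / x + y} -> (forall c x, G (c%:MP *: x) = c *: G x) ->
  (forall k x, G ('X_k *: x) = G x *m A k + mx_eval x *m A' k) ->
  (forall j, G (delta_mx 0 j) = 0) -> G =1 def_deriv A'.
Proof.
move=> GD GC GX Ge f; rewrite /def_deriv /def_eval.
rewrite -(gen_eval_unique (T := def_act A') (e := fun j => (e j, 0))
  (G := fun g => (mx_eval g, G g))) //=.
- by move=> x y; rewrite /mx_eval evD GD.
- by move=> c x; rewrite /mx_eval evC GC.
- by move=> k x; rewrite /mx_eval evX GX.
- by move=> j; rewrite /mx_eval gen_eval_delta Ge.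
Qed.

(** On the kernel the Leibniz term containing the value of [f] disappears. Hence the derivative is
    linear over the polynomial ring there. *)
Lemma def_deriv_ker p f : mx_ker f ->
  def_deriv A' (p *: f) = poly_act mx_act p (def_deriv A' f).
Proof.
move=> kf; rewrite /def_deriv /def_eval.
rewrite (gen_evalZ def_act_linear def_act_comm) -/(def_eval A').
have := def_eval1 f; rewrite kf; case: (def_eval A' f) => _ w /= ->.
(* On [eps V] the deformed action agrees with the original one; [G] expresses this as an equivariant
   map from the ring itself. *)
pose G (q : {mpoly F[m]}^o) : 'rV[F]_d * 'rV[F]_d := (0, poly_act mx_act q w).
have -> : (0, w) = G 1 by rewrite /G poly_act1.
rewrite -(equivariant_poly_act (T := def_act A') (G := G)).
- by rewrite /G /= [p *: _]mulr1.
- by move=> x y; rewrite /G poly_actDl; congr pair; rewrite addr0.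
- move=> c x; rewrite /G (poly_actM mx_act_linear mx_act_comm) poly_actC.
  by congr pair; rewrite scaler0.
- move=> i x; rewrite /G /def_act /= (poly_actM mx_act_linear mx_act_comm).
  by rewrite poly_actX !mul0mx addr0.
Qed.

Lemma def_deriv_hom : hom_pred mx_ker (lift_row \o def_deriv A').
Proof.
split=> [k k' _ _|p k kk]; rewrite /mx_ker /=.
  by rewrite def_derivD lift_rowD subrr /mx_eval ev0.
by rewrite /mx_eval evB evZ -/mx_eval !mx_eval_lift (def_deriv_ker _ kk) subrr.
Qed.

End Deformation.

(** The commutation equations and the Leibniz rule are linear in [A']. The combination is given
    pointwise in [k], so no equality between functions is required. *)
Lemma def_deriv_sum n (t : 'I_n -> 'I_m -> 'M[F]_d) (c : 'I_n -> F) A' :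
  (forall i, lin_comm (t i)) -> (forall k, A' k = \sum_i c i *: t i k) ->
  lin_comm A' /\ forall f, def_deriv A' f = \sum_i c i *: def_deriv (t i) f.
Proof.
move=> ct A'E; have cA' : lin_comm A'.
  move=> k l; rewrite !A'E !mulmx_sumr !mulmx_suml -!big_split /=.
  by apply: eq_bigr => i _; rewrite -!scalemxAr -!scalemxAl -!scalerDr ct.
split=> // f; apply/esym; move: f; apply: def_deriv_unique => //.
- move=> x y; rewrite -big_split; apply: eq_bigr => i _ /=.
  by rewrite def_derivD scalerDr.
- move=> a x; rewrite scaler_sumr; apply: eq_bigr => i _.
  by rewrite def_derivC // !scalerA mulrC.
- move=> k x; rewrite A'E mulmx_suml mulmx_sumr -big_split; apply: eq_bigr => i _.
  by rewrite def_derivX //= scalerDr scalemxAl scalemxAr.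
- by move=> j; rewrite big1 // => i _; rewrite def_deriv_delta scaler0.
Qed.

Hypothesis gens_in_basis : forall j, exists i, b i = delta_mx 0 j.

(* The equations [def_deriv A' (b i) = 0] pick one deformation in each orbit
   of the infinitesimal conjugation action. *)
Definition normal_def A' := lin_comm A' /\ forall i, def_deriv A' (b i) = 0.

Lemma normal_def_ext A1 A2 : A1 =1 A2 -> normal_def A1 -> normal_def A2.
Proof.
move=> E [c1 n1].
have [k|c2 D2] := def_deriv_sum (t := fun _ : 'I_1 => A1) (c := fun=> 1) (A' := A2) (fun=> c1).
  by rewrite big_ord1 scale1r E.
by split=> // i; rewrite D2 big_ord1 n1 scaler0.
Qed.

(** The free module is the kernel plus the span of the lifts [b i], and both derivatives vanish on
    that span. Agreement on the kernel is thus agreement everywhere, and the derivative of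
    ['X_k *: b i] is row [i] of the [k]-th matrix. *)
Lemma normal_def_inj A1 A2 : normal_def A1 -> normal_def A2 ->
  (forall f, mx_ker f -> def_deriv A1 f = def_deriv A2 f) -> A1 =1 A2.
Proof.
move=> [c1 n1] [c2 n2] E k.
have lift0 A' c : normal_def A' -> def_deriv A' (lift_row c) = 0.
  move=> [cA' nA']; rewrite /lift_row.
  rewrite (big_morph _ (def_derivD A') (id1 := 0)); last first.
    by rewrite -(scale0r 0) -mpolyC0 def_derivC // scale0r.
  by rewrite big1 // => i _; rewrite def_derivC // nA' scaler0.
have E' f : def_deriv A1 f = def_deriv A2 f.
  have kf := mx_ker_proj f; have fE := subrK (lift_row (mx_eval f)) f.
  by rewrite -[f]fE (def_derivD A1) (def_derivD A2) (E _ kf)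
    (lift0 A1 _ (conj c1 n1)) (lift0 A2 _ (conj c2 n2)).
apply/row_matrixP => i; have := E' ('X_k *: b i).
by rewrite !def_derivX // n1 n2 !mul0mx !add0r evb !rowE.
Qed.

Lemma derivation_lin_comm (D : 'rV[{mpoly F[m]}]_r -> 'rV[F]_d) A' :
  (forall i, D (b i) = 0) ->
  (forall k f, D ('X_k *: f) = D f *m A k + mx_eval f *m A' k) -> lin_comm A'.
Proof.
move=> Db DX k l; apply/row_matrixP => i.
have Db_var n : D ('X_n *: b i) = row i (A' n).
  by rewrite DX Db mul0mx add0r evb -rowE.
have evb_var n : mx_eval ('X_n *: b i) = row i (A n).
  by rewrite /mx_eval evX -/mx_eval evb /mx_act -rowE.
(* Expanding [D] on the two orders of multiplication by the Leibniz rule gives row [i] of the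
   commutation equation. *)
have : 'X_k *: ('X_l *: b i) = 'X_l *: ('X_k *: b i) by rewrite !scalerA mulrC.
move/(congr1 D); rewrite DX Db_var evb_var DX Db_var evb_var => E.
by rewrite !raddfD /= !row_mul addrC -E addrC.
Qed.

(** * From homomorphisms back to normalised deformations *)

Section HomToDeformation.
Context (phi : 'rV[{mpoly F[m]}]_r -> 'rV[{mpoly F[m]}]_r).
Hypothesis hom_phi : hom_pred mx_ker phi.

Let psi f := mx_eval (phi f).
Let proj f := f - lift_row (mx_eval f).
Let D f := psi (proj f).
(** [D] extends the homomorphism from the kernel to the free module by zero on the span of the
    [b i]. Its values on ['X_k *: b i] are forced to be the rows of the deformation matrices. *)
Definition def_of_hom (k : 'I_m) := \matrix_i D ('X_k *: b i).

Let ker_proj f : mx_ker (proj f) := mx_ker_proj f.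

Let projK f : mx_ker f -> proj f = f.
Proof. by rewrite /proj => ->; rewrite lift_row0 subr0. Qed.

Let psiD f g : mx_ker f -> mx_ker g -> psi (f + g) = psi f + psi g.
Proof.
move=> kf kg; apply/subr0_eq; have := hom_phi.1 f g kf kg.
by rewrite /mx_ker /mx_eval evB evD.
Qed.

Let psiZ p f : mx_ker f -> psi (p *: f) = poly_act mx_act p (psi f).
Proof.
move=> kf; apply/subr0_eq; have := hom_phi.2 p f kf.
by rewrite /mx_ker /mx_eval evB evZ.
Qed.

Let DD : {morph D : f g / f + g}.
Proof.
move=> f g; rewrite /D -psiD //; congr psi.
by rewrite /proj /mx_eval evD lift_rowD opprD addrACA.
Qed.

Let DC c f : D (c%:MP *: f) = c *: D f.
Proof.
rewrite /D -(poly_actC mx_act) -psiZ //; congr psi.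
by rewrite /proj /mx_eval evC lift_rowZ scalerBr.
Qed.

Let D0 : D 0 = 0.
Proof. by rewrite -(scale0r 0) -mpolyC0 DC scale0r. Qed.

Let Db i : D (b i) = 0.
Proof. by rewrite -D0 /D /proj evb lift_row_delta subrr /mx_eval ev0 lift_row0 subr0. Qed.

Let DX k f : D ('X_k *: f) = D f *m A k + mx_eval f *m def_of_hom k.
Proof.
(* Split [f] into its kernel part, where [D] is linear over the ring, and its part in the span of
   the [b i], where the matrix rows appear. *)
rewrite -[in LHS](subrK (lift_row (mx_eval f)) f) scalerDr DD; congr (_ + _).
  have kf := ker_proj f.
  rewrite /D projK; last by case: mx_ker_submodule => _ _; apply.
  by rewrite psiZ // poly_actX.
rewrite /lift_row scaler_sumr (big_morph _ DD D0) mulmx_sum_row.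
by apply: eq_bigr => i _; rewrite rowK scalerA mulrC -scalerA DC.
Qed.

Lemma def_of_hom_comm : lin_comm def_of_hom.
Proof. exact: derivation_lin_comm Db DX. Qed.

Lemma def_of_homE : D =1 def_deriv def_of_hom.
Proof.
have De j : D (delta_mx 0 j) = 0 by have [i <-] := gens_in_basis j; apply: Db.
exact: (def_deriv_unique DD DC DX De).
Qed.

Lemma def_of_hom_normal : normal_def def_of_hom.
Proof. by split=> [|i]; [exact: def_of_hom_comm | rewrite -def_of_homE Db]. Qed.

Lemma def_of_hom_ker f : mx_ker f -> mx_eval (phi f) = def_deriv def_of_hom f.
Proof. by move=> kf; rewrite -def_of_homE /D projK. Qed.

End HomToDeformation.

(** Restricting the derivative to the kernel is a linear bijection from normalised deformations onto
    homomorphisms, so a basis of the former is carried to a basis of the latter. *)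
Lemma mx_ker_hom_dim n (t : 'I_n -> 'I_m -> 'M[F]_d) :
  (forall i, normal_def (t i)) ->
  (forall A', normal_def A' -> exists c : {ffun 'I_n -> F},
     (forall k, A' k = \sum_i c i *: t i k) /\
     forall c' : {ffun 'I_n -> F}, (forall k, A' k = \sum_i c' i *: t i k) -> c' = c) ->
  hom_dim_pred mx_ker n.
Proof.
move=> nt basis_t; have ct i : lin_comm (t i) by case: (nt i).
exists (fun i => lift_row \o def_deriv (t i)).
split=> [i|phi hphi]; first exact: def_deriv_hom.
have nA' := def_of_hom_normal hphi; set A' := def_of_hom phi in nA'.
have [c [A'c c_uniq]] := basis_t _ nA'.
have E c' f : mx_ker f ->
    mx_ker (phi f - \sum_i (c' i)%:MP *: (lift_row \o def_deriv (t i)) f) <->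
    def_deriv A' f = \sum_i c' i *: def_deriv (t i) f.
  move=> kf; rewrite /mx_ker /mx_eval evB ev_sum -/mx_eval def_of_hom_ker //.
  under eq_bigr do rewrite -/mx_eval /= mx_eval_lift.
  by split=> [/subr0_eq //|->]; rewrite subrr.
exists c; split=> [f kf|c' c'E].
  by apply/E => //; have [_ ->] := def_deriv_sum ct A'c.
(* Coefficients [c'] representing [phi] define a normalised deformation with the same derivative on
   the kernel; injectivity makes it equal to [A']. *)
pose B k := \sum_i c' i *: t i k.
have [cB BE] := def_deriv_sum (A' := B) ct (fun=> erefl).
apply: c_uniq => k; apply: (normal_def_inj nA' (A2 := B)).
  by split=> // i; rewrite BE big1 // => j _; have [_ ->] := nt j; rewrite scaler0.
by move=> f kf; rewrite BE; apply/E => //; exact: c'E.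
Qed.

End Presentation.

(** * Disjoint unions and free summands *)

Section Submodules.
Context (F : fieldType) (m : nat).
Local Notation Poly := {mpoly F[m]}.

(** This says that [f] annihilates the quotient by [K]. *)
Definition kills r (f : Poly) (K : 'rV[Poly]_r -> Prop) := forall u, K (f *: u).

Definition pick_coef d1 d2 (c1 : 'I_d1 -> F) (c2 : 'I_d2 -> F) :
    {ffun 'I_(d1 + d2) -> F} :=
  [ffun i => match split i with inl a => c1 a | inr b => c2 b end].

Lemma pick_coefl d1 d2 (c1 : 'I_d1 -> F) (c2 : 'I_d2 -> F) i :
  pick_coef c1 c2 (lshift d2 i) = c1 i.
Proof. by rewrite ffunE -[lshift _ _]/(unsplit (inl _)) unsplitK. Qed.

Lemma pick_coefr d1 d2 (c1 : 'I_d1 -> F) (c2 : 'I_d2 -> F) i :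
  pick_coef c1 c2 (rshift d1 i) = c2 i.
Proof. by rewrite ffunE -[rshift _ _]/(unsplit (inr _)) unsplitK. Qed.

Lemma pick_coef_eq d1 d2 (c : {ffun 'I_(d1 + d2) -> F}) (c1 : {ffun 'I_d1 -> F}) c2 :
  [ffun i => c (lshift d2 i)] = c1 -> [ffun i => c (rshift d1 i)] = c2 ->
  c = pick_coef c1 c2.
Proof.
move=> /ffunP E1 /ffunP E2; apply/ffunP => i; rewrite -(splitK i).
case: (split i) => j /=.
  by rewrite pick_coefl -E1 ffunE.
by rewrite pick_coefr -E2 ffunE.
Qed.

Section Closure.
Context (r : nat) (K : 'rV[Poly]_r -> Prop) (sK : submodule_pred K).

Lemma submodD u v : K u -> K v -> K (u + v).
Proof. by case: sK => _ + _; apply. Qed.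

Lemma submodZ p u : K u -> K (p *: u).
Proof. by case: sK => _ _; apply. Qed.

Lemma submodB u v : K u -> K v -> K (u - v).
Proof. by move=> Ku Kv; rewrite -scaleN1r; apply: submodD => //; apply: submodZ. Qed.

Lemma submod_trans v u w : K (u - v) -> K (v - w) -> K (u - w).
Proof. by move=> uv vw; have := submodD uv vw; rewrite addrA subrK. Qed.

Lemma submod_sym u v : K (u - v) -> K (v - u).
Proof. by rewrite -[v - u]opprB -(scaleN1r (u - v)); apply: submodZ. Qed.

Lemma submod_sum (I : Type) (s : seq I) (f : I -> 'rV[Poly]_r) :
  (forall i, K (f i)) -> K (\sum_(i <- s) f i).
Proof.
by move=> Kf; elim/big_ind: _ => //; [case: sK | apply: submodD].
Qed.

Lemma submod_congr u v : K (u - v) -> K u <-> K v.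
Proof.
move=> Kuv; split=> [Ku|Kv]; last by rewrite -(subrK v u); apply: submodD.
by rewrite -[v](subKr u); apply: submodB.
Qed.

Lemma hom_pred_sum n (b : 'I_n -> 'rV[Poly]_r -> 'rV[Poly]_r) (c : 'I_n -> F) p k :
  (forall i, hom_pred K (b i)) -> K k ->
  K (\sum_i (c i)%:MP *: b i (p *: k) - p *: \sum_i (c i)%:MP *: b i k).
Proof.
move=> hb Kk; rewrite scaler_sumr -sumrB; apply: submod_sum => i.
rewrite scalerA [p * _]mulrC -scalerA -scalerBr; apply: submodZ.
exact: (hb i).2.
Qed.

End Closure.

(** * Homomorphisms from an intersection of comaximal submodules *)

Section Glue.
Context (r : nat) (K P L : 'rV[Poly]_r -> Prop) (f : Poly).
Hypothesis sK : submodule_pred K.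
Hypothesis LE : forall u, L u <-> K u /\ P u.
Hypothesis fK : kills f K.
Hypothesis fP : kills (1 - f) P.

Lemma kills_compl_mod u : K (u - (1 - f) *: u).
Proof. by rewrite -{1}[u]scale1r -scalerBl subKr. Qed.

(** Modulo [K], multiplication by [1 - f] is the identity and multiplication by [f] is zero. *)
Lemma glue_congr u s t : K (u - ((1 - f) *: s + f *: t)) <-> K (u - s).
Proof.
apply: submod_congr => //; rewrite opprB addrC addrA subrK opprD addrA.
by apply: submodB => //; apply: kills_compl_mod.
Qed.

(** Multiplication by [1 - f] carries [K] into [L] and is the identity modulo [K]. Precomposing with
    it extends a homomorphism from [L] to [K] without changing its values modulo [K], so a basis for
    homomorphisms on [K] remains one on [L]. *)
Lemma glue_hom_restrict n (b : 'I_n -> 'rV[Poly]_r -> 'rV[Poly]_r) phi :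
  (forall i, hom_pred K (b i)) ->
  (forall psi, hom_pred K psi -> exists c : {ffun 'I_n -> F},
     (forall k, K k -> K (psi k - \sum_i (c i)%:MP *: b i k)) /\
     forall c' : {ffun 'I_n -> F},
       (forall k, K k -> K (psi k - \sum_i (c' i)%:MP *: b i k)) -> c' = c) ->
  hom_pred L phi -> exists c : {ffun 'I_n -> F},
    (forall k, L k -> K (phi k - \sum_i (c i)%:MP *: b i k)) /\
    forall c' : {ffun 'I_n -> F},
      (forall k, L k -> K (phi k - \sum_i (c' i)%:MP *: b i k)) -> c' = c.
Proof.
move=> hb basis_b [phiD phiZ].
have Lq k : K k -> L ((1 - f) *: k) by move=> Kk; apply/LE; split=> //; apply: submodZ.
have LK u : L u -> K u by move=> /LE[].
have hq : hom_pred K (fun k => phi ((1 - f) *: k)).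
  split=> [k k' Kk Kk'|p k Kk].
    by rewrite scalerDr; apply/LK/phiD; apply: Lq.
  by rewrite scalerA mulrC -scalerA; apply/LK/phiZ/Lq.
have phi_q k : L k -> K (phi k - phi ((1 - f) *: k)).
  move=> Lk; apply: (submod_trans sK (kills_compl_mod (phi k))).
  exact: (submod_sym sK (LK _ (phiZ (1 - f) k Lk))).
have [c [cE c_uniq]] := basis_b _ hq; exists c; split=> [k Lk|c' c'E].
  exact: (submod_trans sK (phi_q k Lk) (cE k (LK _ Lk))).
apply: c_uniq => k Kk; apply: (submod_trans sK (c'E _ (Lq _ Kk))).
apply: (submod_trans sK (hom_pred_sum sK c' (1 - f) hb Kk)).
exact: (submod_sym sK (kills_compl_mod _)).
Qed.

End Glue.

(** * Additivity of both dimensions under disjoint union *)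

Section GlueDim.
Context (r : nat) (K P : 'rV[Poly]_r -> Prop) (f : Poly).
Hypotheses (sK : submodule_pred K) (sP : submodule_pred P).
Hypotheses (fK : kills f K) (fP : kills (1 - f) P).

Definition meet_pred u := K u /\ P u.

Let fP' : kills (1 - (1 - f)) K. Proof. by rewrite subKr. Qed.
Let KL u : meet_pred u <-> K u /\ P u. Proof. by []. Qed.
Let PL u : meet_pred u <-> P u /\ K u. Proof. by split=> -[]. Qed.

Lemma meet_submodule : submodule_pred meet_pred.
Proof.
split=> [|u v [Ku Pu] [Kv Pv]|p u [Ku Pu]].
- by split; [case: sK | case: sP].
- by split; apply: submodD.
- by split; apply: submodZ.
Qed.

(** The Chinese remainder theorem: the glued element represents [s] modulo [K] and [t] modulo
    [P]. *)
Lemma glue_mem u s t : meet_pred (u - ((1 - f) *: s + f *: t)) <->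
  K (u - s) /\ P (u - t).
Proof.
have HK := glue_congr sK fK u s t.
have HP := glue_congr (f := 1 - f) sP fP u t s.
by rewrite subKr [f *: t + _]addrC in HP; rewrite /meet_pred; tauto.
Qed.

Let glue_fam d1 d2 (v : 'I_d1 -> 'rV[Poly]_r) (w : 'I_d2 -> 'rV[Poly]_r)
    (i : 'I_(d1 + d2)) :=
  match split i with inl a => (1 - f) *: v a | inr b => f *: w b end.

Let glue_sum d1 d2 (c : 'I_(d1 + d2) -> F) (v : 'I_d1 -> 'rV[Poly]_r) w :
  \sum_i (c i)%:MP *: glue_fam v w i =
  (1 - f) *: (\sum_i (c (lshift d2 i))%:MP *: v i) +
  f *: (\sum_i (c (rshift d1 i))%:MP *: w i).
Proof.
rewrite big_split_ord /= !scaler_sumr; congr (_ + _); apply: eq_bigr => i _;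
  rewrite /glue_fam.
  by rewrite -[lshift _ _]/(unsplit (inl _)) unsplitK /= !scalerA mulrC.
by rewrite -[rshift _ _]/(unsplit (inr _)) unsplitK /= !scalerA mulrC.
Qed.

Lemma meet_quot_dim d1 d2 : quot_dim_pred K d1 -> quot_dim_pred P d2 ->
  quot_dim_pred meet_pred (d1 + d2).
Proof.
move=> [v vE] [w wE]; exists (glue_fam v w) => u.
have [c1 [c1E c1u]] := vE u; have [c2 [c2E c2u]] := wE u.
exists (pick_coef c1 c2); split=> [|c].
  rewrite glue_sum; apply/glue_mem; split.
    by under eq_bigr do rewrite pick_coefl.
  by under eq_bigr do rewrite pick_coefr.
rewrite glue_sum => /glue_mem[Ku Pu]; apply: pick_coef_eq.
  by apply: c1u; under eq_bigr do rewrite ffunE.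
by apply: c2u; under eq_bigr do rewrite ffunE.
Qed.

(** The quotient by the intersection splits as a direct sum, and homomorphisms into each summand are
    counted by [glue_hom_restrict], applied once with [f] and once with [1 - f]. *)
Lemma meet_hom_dim n1 n2 : hom_dim_pred K n1 -> hom_dim_pred P n2 ->
  hom_dim_pred meet_pred (n1 + n2).
Proof.
move=> [v [hv vE]] [w [hw wE]].
exists (fun i k => glue_fam (v^~ k) (w^~ k) i); split=> [i|phi hphi].
  rewrite /glue_fam; case: (split i) => j.
    split=> [k k' [Kk _] [Kk' _]|p k [Kk _]].
      rewrite -scalerDr -scalerBr; split=> //; apply: submodZ => //.
      exact: (hv j).1.
    rewrite scalerA mulrC -scalerA -scalerBr; split=> //; apply: submodZ => //.
    exact: (hv j).2.
  split=> [k k' [_ Pk] [_ Pk']|p k [_ Pk]].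
    rewrite -scalerDr -scalerBr; split=> //; apply: submodZ => //.
    exact: (hw j).1.
  rewrite scalerA mulrC -scalerA -scalerBr; split=> //; apply: submodZ => //.
  exact: (hw j).2.
have [c1 [c1E c1u]] := glue_hom_restrict sK KL fK fP hv vE hphi.
have [c2 [c2E c2u]] := glue_hom_restrict sP PL fP fP' hw wE hphi.
exists (pick_coef c1 c2); split=> [k Lk|c cE].
  rewrite glue_sum; apply/glue_mem; split.
    by under eq_bigr do rewrite pick_coefl; apply: c1E.
  by under eq_bigr do rewrite pick_coefr; apply: c2E.
apply: pick_coef_eq.
  apply: c1u => k Lk; have := cE k Lk; rewrite glue_sum => /glue_mem[Kk _].
  by under eq_bigr do rewrite ffunE.
apply: c2u => k Lk; have := cE k Lk; rewrite glue_sum => /glue_mem[_ Pk].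
by under eq_bigr do rewrite ffunE.
Qed.

End GlueDim.

(** * Adding a free summand to the submodule *)

Section FreeSummand.
Context (r : nat) (K : 'rV[Poly]_r -> Prop) (sK : submodule_pred K).

Definition add_free (u : 'rV[Poly]_(1 + r)) : Prop := K (rsubmx u).

Let r0 (v : 'rV[Poly]_r) : 'rV[Poly]_(1 + r) := row_mx 0 v.

Lemma add_free_submodule : submodule_pred add_free.
Proof.
split=> [|u v|p u]; rewrite /add_free.
- by rewrite linear0; case: sK.
- by rewrite linearD; apply: submodD.
- by rewrite linearZ; apply: submodZ.
Qed.

Lemma add_free_kills f : kills f K -> kills f add_free.
Proof. by move=> fK u; rewrite /add_free linearZ; apply: fK. Qed.

Let rsub_sum n (c : 'I_n -> F) (g : 'I_n -> 'rV[Poly]_r) u :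
  rsubmx (u - \sum_i (c i)%:MP *: r0 (g i)) =
  rsubmx u - \sum_i (c i)%:MP *: g i.
Proof.
rewrite linearB linear_sum; congr (_ - _); apply: eq_bigr => i _.
by rewrite linearZ /= row_mxKr.
Qed.

Lemma add_free_quot_dim d : quot_dim_pred K d -> quot_dim_pred add_free d.
Proof.
move=> [v vE]; exists (fun i => r0 (v i)) => u.
have [c [cE c_uniq]] := vE (rsubmx u); exists c.
by rewrite /add_free rsub_sum; split=> // c'; rewrite rsub_sum; apply: c_uniq.
Qed.

Let eps : 'rV[Poly]_(1 + r) := row_mx 1%:M 0.

Let decomp (u : 'rV[Poly]_(1 + r)) : u = r0 (rsubmx u) + lsubmx u 0 0 *: eps.
Proof.
rewrite -{1}[u]hsubmxK /r0 /eps scale_row_mx add_row_mx add0r scaler0 addr0.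
by congr row_mx; rewrite scalemx1 -mx11_scalar.
Qed.

Let free_hom n d (b : 'I_n -> 'rV[Poly]_r -> 'rV[Poly]_r)
    (v : 'I_d -> 'rV[Poly]_r) (i : 'I_(n + d)) (u : 'rV[Poly]_(1 + r)) :=
  match split i with
  | inl a => r0 (b a (rsubmx u))
  | inr j => lsubmx u 0 0 *: r0 (v j)
  end.

Let free_hom_sum n d (b : 'I_n -> 'rV[Poly]_r -> 'rV[Poly]_r)
    (v : 'I_d -> 'rV[Poly]_r) (c : 'I_(n + d) -> F) w u :
  rsubmx (w - \sum_i (c i)%:MP *: free_hom b v i u) =
  rsubmx w - (\sum_i (c (lshift d i))%:MP *: b i (rsubmx u) +
              lsubmx u 0 0 *: \sum_j (c (rshift n j))%:MP *: v j).
Proof.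
rewrite linearB linear_sum /=; congr (_ - _).
rewrite big_split_ord scaler_sumr; congr (_ + _); apply: eq_bigr => i _;
  rewrite /free_hom linearZ /=.
  by rewrite -[lshift _ _]/(unsplit (inl _)) unsplitK row_mxKr.
rewrite -[rshift _ _]/(unsplit (inr _)) unsplitK linearZ /= row_mxKr.
by rewrite !scalerA mulrC.
Qed.

(** With [M] the unchanged quotient, a homomorphism from the sum of [R] and [K] to [M] is a
    homomorphism from [K] together with an arbitrary image in [M] of the new generator [eps]; the
    latter contributes [d]. *)
Lemma add_free_hom_dim n d : hom_dim_pred K n -> quot_dim_pred K d ->
  hom_dim_pred add_free (n + d).
Proof.
move=> [b [hb bE]] [v vE]; exists (free_hom b v); split=> [i|phi [phiD phiZ]].
  rewrite /free_hom; case: (split i) => j; split=> [k k' Kk Kk'|p k Kk];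
    rewrite /add_free.
  - by rewrite linearB !linearD /= !row_mxKr -opprD; apply: (hb j).1.
  - rewrite linearB /= [rsubmx (p *: r0 _)]linearZ /= [rsubmx (p *: k)]linearZ /=.
    by rewrite !row_mxKr; apply: (hb j).2.
  - by rewrite [lsubmx (k + k')]linearD mxE scalerDl subrr linear0; case: sK.
  - by rewrite [lsubmx (p *: k)]linearZ mxE scalerA subrr linear0; case: sK.
have Kr0 k : K k -> add_free (r0 k) by rewrite /add_free row_mxKr.
have Keps : add_free eps by rewrite /add_free row_mxKr; case: sK.
have h1 : hom_pred K (fun k => rsubmx (phi (r0 k))).
  split=> [k k' Kk Kk'|p k Kk].
    have := phiD _ _ (Kr0 _ Kk) (Kr0 _ Kk').
    by rewrite /add_free linearB linearD /= /r0 add_row_mx addr0.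
  have := phiZ p _ (Kr0 _ Kk).
  by rewrite /add_free linearB linearZ /= /r0 scale_row_mx scaler0.
have phiE u : add_free u -> K (rsubmx (phi u) -
    (rsubmx (phi (r0 (rsubmx u))) + lsubmx u 0 0 *: rsubmx (phi eps))).
  move=> Ku; have Ku1 := Kr0 _ Ku.
  have Ku2 : add_free (lsubmx u 0 0 *: eps) by apply: submodZ add_free_submodule _ _ Keps.
  have := phiD _ _ Ku1 Ku2; rewrite -decomp => H1.
  have H2 := phiZ (lsubmx u 0 0) _ Keps.
  have := submodD add_free_submodule H1 H2.
  rewrite opprD !addrA subrK -addrA -opprD /add_free !raddfB raddfD /=.
  by rewrite [rsubmx (_ *: _)]linearZ.
have [c1 [c1E c1u]] := bE _ h1; have [c2 [c2E c2u]] := vE (rsubmx (phi eps)).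
exists (pick_coef c1 c2); split=> [u Ku|c cE].
  rewrite /add_free free_hom_sum; apply: (submod_trans sK (phiE u Ku)).
  rewrite (eq_bigr (fun i => (c1 i)%:MP *: b i (rsubmx u))); last first.
    by move=> i _; rewrite pick_coefl.
  rewrite (eq_bigr (fun j => (c2 j)%:MP *: v j)); last first.
    by move=> i _; rewrite pick_coefr.
  rewrite opprD addrACA -scalerBr; apply: submodD => //; first exact: c1E.
  exact: submodZ.
apply: pick_coef_eq.
  apply: c1u => k Kk; have := cE _ (Kr0 _ Kk).
  rewrite /add_free free_hom_sum row_mxKr row_mxKl mxE scale0r addr0.
  rewrite (eq_bigr (fun i => ([ffun i => c (lshift d i)] i)%:MP *: b i k)) //.
  by move=> i _; rewrite ffunE.
apply: c2u; have := cE _ Keps.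
rewrite /add_free free_hom_sum row_mxKr row_mxKl mxE scale1r.
rewrite (eq_bigr (fun j => ([ffun i => c (rshift n i)] j)%:MP *: v j)); last first.
  by move=> i _; rewrite ffunE.
(* Here each [b i] is evaluated at 0, where a representative is only known to lie in [K], so this
   sum is discarded modulo [K]. *)
set s := \sum_i _ => H; have Ks : K s.
  apply: submod_sum => // i; apply: submodZ => //.
  have K0 : K 0 by case: sK.
  by have := (hb i).2 0 0 K0; rewrite !scale0r subr0.
by have := submodD sK H Ks; rewrite opprD addrA addrAC subrK.
Qed.

End FreeSummand.
End Submodules.

(** * Rank of a sparse integral system *)

Section Elimination.
Context (T : eqType).
Implicit Types (x y : T) (e : seq (T * int)).

Fixpoint coef x e : int :=
  if e is (y, c) :: e' then if y == x then c + coef x e' else coef x e' else 0.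

Fixpoint add_term x (c : int) e : seq (T * int) :=
  if e is (y, c') :: e' then
    if y == x then let s := c + c' in if s == 0 then e' else (x, s) :: e'
    else (y, c') :: add_term x c e'
  else [:: (x, c)].

Definition add_eqn a e1 e2 : seq (T * int) :=
  foldr (fun t e => add_term t.1 (a * t.2) e) e2 e1.

(** Cross-multiplication by the pivot coefficient keeps all coefficients integral. *)
Definition eliminate x c e e' : seq (T * int) :=
  let c' := coef x e' in
  if c' == 0 then e' else add_eqn (- c') e (add_eqn c e' [::]).

(** Each round consumes one equation and pivots on its leading variable, so the number of equations
    is enough fuel. [None] reports an unusable pivot or exhausted fuel. *)
Fixpoint elim_rank (valid : pred T) n (E : seq (seq (T * int))) : option nat :=
  if n is n'.+1 then
    if E is e :: E' then
      if e is (x, _) :: _ then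
        let c := coef x e in
        if valid x && (c != 0) then
          omap succn (elim_rank valid n' [seq eliminate x c e e' | e' <- E'])
        else None
      else elim_rank valid n' E'
    else Some 0%N
  else if E is [::] then Some 0%N else None.

Lemma coef_add_term x y c e :
  coef x (add_term y c e) = (if y == x then c else 0) + coef x e.
Proof.
elim: e => [|[z c'] e IHe] /=; first by case: ifP; rewrite !addr0.
case: (eqVneq z y) => [->|zy] /=.
  case: (eqVneq y x) => [->|yx] /=; case: (eqVneq (c + c') 0) => [s0|_] /=.
  - by rewrite addrA s0 add0r.
  - by rewrite eqxx addrA.
  - by rewrite add0r.
  - by rewrite (negPf yx) add0r.
by rewrite IHe; case: (z == x) => //; rewrite addrCA.
Qed.

Lemma coef_add_eqn x a e1 e2 :
  coef x (add_eqn a e1 e2) = a * coef x e1 + coef x e2.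
Proof.
elim: e1 => [|[y c] e1 IHe] /=; first by rewrite mulr0 add0r.
rewrite coef_add_term IHe addrA; congr (_ + _).
by case: (y == x); rewrite ?mulrDr ?add0r.
Qed.

Context (F : numFieldType) (N : nat) (key : 'I_N -> T) (valid : pred T).
Hypothesis validP : forall x, valid x -> exists i, key i = x.

Definition eqn_row e : 'rV[F]_N := \row_i (coef (key i) e)%:~R.
(** The row space is formed as a sum of lines, which gives a square matrix of fixed size and suits
    induction on the list. *)
Definition eqns_mx (E : seq (seq (T * int))) : 'M[F]_N :=
  (\sum_(e <- E) <<eqn_row e>>)%MS.

Lemma eqns_mx_sub p (C : 'M[F]_(p, N)) E :
  (eqns_mx E <= C)%MS = all (fun e => (eqn_row e <= C)%MS) E.
Proof.
rewrite /eqns_mx; elim: E => [|e E IHE]; first by rewrite big_nil sub0mx.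
by rewrite big_cons addsmx_sub genmxE IHE.
Qed.

Lemma eqn_row_sub e E : e \in E -> (eqn_row e <= eqns_mx E)%MS.
Proof. by move=> eE; have := submx_refl (eqns_mx E); rewrite eqns_mx_sub => /allP->. Qed.

(** The nonzero factor [a] lets the old row be recovered from the new one and the pivot row; the
    vanishing entry makes the pivot row independent of all reduced rows. *)
Lemma eqn_row_eliminate x (c : int) e e' : c != 0 ->
  exists a b : F, [/\ a != 0,
    eqn_row (eliminate x c e e') = a *: eqn_row e' + b *: eqn_row e &
    (coef x e = c -> forall i, key i = x -> eqn_row (eliminate x c e e') 0 i = 0)].
Proof.
move=> c0; rewrite /eliminate; case: eqVneq => [e'0|_].
  exists 1, 0; rewrite oner_neq0 scale1r scale0r addr0; split=> // _ i ix.
  by rewrite mxE ix e'0.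
exists c%:~R, (- coef x e')%:~R; rewrite intr_eq0; split=> // [|ec i ix].
  by apply/rowP => i; rewrite !mxE !coef_add_eqn addr0 rmorphD !rmorphM addrC.
by rewrite mxE ix !coef_add_eqn addr0 ec mulNr mulrC addNr.
Qed.

Lemma elim_rankP n E k : elim_rank valid n E = Some k -> \rank (eqns_mx E) = k.
Proof.
elim: n E k => [|n IHn] [|e E] k //=; try by case=> <-; rewrite /eqns_mx big_nil mxrank0.
case: e => [|[x c0] e0].
  move/IHn => <-; rewrite /eqns_mx big_cons; congr (\rank _).
  have -> : eqn_row [::] = 0 by apply/rowP => i; rewrite !mxE.
  by rewrite genmx0 adds0mx_id // -/(eqns_mx E) /eqns_mx; elim/big_ind: _.
set e := (x, c0) :: e0; set c := coef x e; case: ifP => // /andP[vx c_neq0].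
case rkE: elim_rank => [k'|] //= -[<-]; move/IHn: rkE => <-; set E' := map _ _.
have [i ix] := validP vx.
have e_i : eqn_row e 0 i != 0 by rewrite mxE ix intr_eq0.
transitivity (\rank (eqn_row e + eqns_mx E')%MS).
  suff /eqmxP-> : (eqns_mx (e :: E) == eqn_row e + eqns_mx E')%MS by [].
  rewrite !addsmx_sub !eqns_mx_sub /=.
  rewrite addsmxSl /=; apply/andP; split.
    apply/allP => e' e'E; have [a [b [a0 E1 _]]] := eqn_row_eliminate x e e' c_neq0.
    have : (eqn_row (eliminate x c e e') <= eqn_row e + eqns_mx E')%MS.
      apply: submx_trans (addsmxSr _ _); apply: eqn_row_sub.
      by apply/mapP; exists e'.
    rewrite E1 => H; rewrite -[eqn_row e']scale1r -(mulVf a0) -scalerA.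
    apply: scalemx_sub; rewrite -[a *: _](addrK (b *: eqn_row e)).
    by rewrite addmx_sub // eqmx_opp scalemx_sub // addsmxSl.
  apply/andP; split; first by rewrite eqn_row_sub // mem_head.
  rewrite all_map; apply/allP => e' e'E /=.
  have [a [b [_ -> _]]] := eqn_row_eliminate x e e' c_neq0.
  by rewrite addmx_sub // scalemx_sub // eqn_row_sub // ?mem_head // in_cons e'E orbT.
(* The sum is direct: the pivot row is nonzero in column [i], while every reduced row vanishes
   there. *)
rewrite mxrank_disjoint_sum ?rank_rV.
  by have -> : eqn_row e != 0 by apply: contraNneq e_i => ->; rewrite mxE.
apply/eqP/rowV0P => v; rewrite sub_capmx => /andP[/sub_rVP[a ->] aE'].
have : (eqns_mx E' <= kermx (delta_mx i 0 : 'cV[F]_N))%MS.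
  rewrite eqns_mx_sub all_map; apply/allP => e' _ /=; apply/sub_kermxP.
  have [_ [_ [_ _ H]]] := eqn_row_eliminate x e e' c_neq0.
  by rewrite -colE; apply/matrixP => p q; have := H erefl i ix; rewrite !mxE.
move/(submx_trans aE')/sub_kermxP; rewrite -scalemxAl -colE => /matrixP/(_ 0 0).
rewrite mxE [RHS]mxE mxE => /eqP; rewrite mulf_eq0 (negPf e_i) orbF => /eqP->.
by rewrite scale0r.
Qed.

Lemma eqns_kerP (u : 'rV[F]_N) E :
  reflect (forall e, e \in E -> \sum_i (coef (key i) e)%:~R * u 0 i = 0)
          (u <= kermx (eqns_mx E)^T)%MS.
Proof.
have -> : (u <= kermx (eqns_mx E)^T)%MS = (eqns_mx E <= kermx u^T)%MS.
  by apply/sub_kermxP/sub_kermxP => /(congr1 trmx);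
    rewrite trmx_mul ?trmxK trmx0.
rewrite eqns_mx_sub; apply: (iffP allP) => H e /H; last first.
  move=> E0; apply/sub_kermxP/matrixP => p q; rewrite !mxE -[RHS]E0.
  by apply: eq_bigr => i _; rewrite !mxE !ord1.
move/sub_kermxP/matrixP/(_ 0 0); rewrite !mxE => {2}<-.
by apply: eq_bigr => i _; rewrite !mxE.
Qed.

Lemma elim_rank_ker n E k : elim_rank valid n E = Some k ->
  \rank (kermx (eqns_mx E)^T) = (N - k)%N.
Proof. by move/elim_rankP => <-; rewrite mxrank_ker mxrank_tr. Qed.

End Elimination.

(** * Modules given by multiplication tables *)

Notation var := (nat * nat * nat)%type.

(* [step k i] is the index of the product of the k-th variable with the i-th
   basis vector, [d] standing for 0.  The i-th entry [(g, w)] of [wd] writes the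
   i-th basis vector as the variables of [w] applied to the g-th generator, the
   head of [w] last.  Variable [(k, i, a)] of the system is the entry [(i, a)] of
   [A'_k]. *)
Section TableData.
Context (d : nat) (tab : seq (seq nat)) (wd : seq (nat * seq nat)).

Definition step k i := nth d (nth [::] tab k) i.
Definition word_index (gw : nat * seq nat) := foldr step (index (gw.1, [::]) wd) gw.2.

(** The last condition requires each word to evaluate to its own basis vector and the set of words
    to be closed under removing the head; this closure supports the inductions on words. *)
Definition table_ok r := [&& all (fun row => size row <= d)%N tab, size wd == d,
  all (fun kl => all (fun i => step kl.1 (step kl.2 i) == step kl.2 (step kl.1 i))
    (iota 0 d)) [seq (k, l) | k <- iota 0 3, l <- iota 0 3],
  all (fun j => (j, [::]) \in wd) (iota 0 r) &
  all (fun i => let: (g, w) := nth (0%N, [::]) wd i in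
    [&& word_index (g, w) == i, (g < r)%N, all (fun k => k < 3)%N w &
        if w is _ :: w' then (g, w') \in wd else true]) (iota 0 d)].

Definition valid_var (x : var) := [&& (x.1.1 < 3)%N, (x.1.2 < d)%N & (x.2 < d)%N].

(** Entry [(i, j)] of the linearised commutator. Multiplying by a table matrix on the left selects
    one row, on the right it sums over preimages of [j]. If [step] returns [d], the product is zero
    and the variable is invalid, to be filtered out in [tangent_eqns]. *)
Definition comm_eqn k l i j : seq (var * int) :=
  (((l, step k i, j), 1) ::
     [seq ((k, i, a), 1) | a <- [seq a <- iota 0 d | step l a == j]]) ++
  (((k, step l i, j), -1) ::
     [seq ((l, i, a), -1) | a <- [seq a <- iota 0 d | step k a == j]]).

(** If both [w] and its extension by [k] are basis words, the row of [A'_k] at [w] must vanish. *)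
Definition gauge_eqns : seq (seq (var * int)) :=
  flatten [seq if gw is (g, k :: w)
    then [seq [:: ((k, index (g, w) wd, a), 1)] | a <- iota 0 d] else [::] | gw <- wd].

(** [add_eqn 1] onto the empty equation merges repeated variables. Pairs with [k < l] suffice by
    symmetry of the commutation equations. *)
Definition tangent_eqns : seq (seq (var * int)) :=
  gauge_eqns ++
  [seq add_eqn 1 [seq t <- comm_eqn kl.1 kl.2 ij.1 ij.2 | valid_var t.1] [::]
     | kl <- [:: (0, 1); (0, 2); (1, 2)]%N,
       ij <- [seq (i, j) | i <- iota 0 d, j <- iota 0 d]].

Definition table_rank := elim_rank valid_var (size tangent_eqns) tangent_eqns.

End TableData.

(** * Correctness of the equations read off from a table *)

Section Table.
Context (F : numFieldType) (d r : nat).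
Context (tab : seq (seq nat)) (wd : seq (nat * seq nat)).
Hypothesis ok : table_ok d tab wd r.
Local Notation Poly := {mpoly F[3]}.
Local Notation step := (step d tab).
Local Notation word_index := (word_index d tab wd).

Let size_tab k : (size (nth [::] tab k) <= d)%N.
Proof.
case/and5P: ok => /allP H _ _ _ _; case: (ltnP k (size tab)) => kt.
  by apply: H; apply: mem_nth.
by rewrite nth_default.
Qed.

Let size_wd : size wd = d. Proof. by case/and5P: ok => _ /eqP. Qed.

Let step_out k i : (d <= i)%N -> step k i = d.
Proof. by move=> di; rewrite /step nth_default // (leq_trans (size_tab k)). Qed.

Let step_comm (k l : 'I_3) i : step k (step l i) = step l (step k i).
Proof.
case: (ltnP i d) => id; last by rewrite !step_out ?step_out.
case/and5P: ok => _ _ /allP H _ _; apply/eqP.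
have /H/allP/(_ i) : (nat_of_ord k, nat_of_ord l) \in [seq (k, l) | k <- iota 0 3, l <- iota 0 3].
  by apply: allpairs_f; rewrite mem_iota ltn_ord.
by rewrite mem_iota => /(_ id).
Qed.

Let gen_wd j : (j < r)%N -> (j, [::]) \in wd.
Proof. by move=> jr; case/and5P: ok => _ _ _ /allP/(_ j); rewrite mem_iota => ->. Qed.

Let wdP g w : (g, w) \in wd -> [/\ word_index (g, w) = index (g, w) wd, (g < r)%N,
  all (fun k => k < 3)%N w & if w is _ :: w' then (g, w') \in wd else true].
Proof.
move=> gw; have lt_d : (index (g, w) wd < d)%N by rewrite -[X in (_ < X)%N]size_wd index_mem.
case/and5P: ok => _ _ _ _ /allP/(_ (index (g, w) wd)).
rewrite mem_iota nth_index // => /(_ lt_d).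
by case/and4P => /eqP wi gr w3 w'; split=> //; move: w'; case: (w).
Qed.

Definition table_mx (k : 'I_3) : 'M[F]_d := \matrix_(i, j) (step k i == j)%:R.
Definition nat_row n (a : nat) : 'rV[F]_n := \row_j (a == j)%:R.
Definition table_gen (j : 'I_r) : 'rV[F]_d := nat_row d (index (nat_of_ord j, [::]) wd).
Definition word_vec (gw : nat * seq nat) : 'rV[Poly]_r :=
  foldr (fun k f => 'X_(inord k) *: f) (\row_j (gw.1 == j)%:R) gw.2.
Definition table_vec (i : 'I_d) := word_vec (nth (0%N, [::]) wd i).

Lemma nat_row_mul a (k : 'I_3) : nat_row d a *m table_mx k = nat_row d (step k a).
Proof.
apply/rowP => j; rewrite !mxE.
case: (ltnP a d) => [ad|da]; last first.
  rewrite step_out // big1 => [|i _]; first by rewrite gtn_eqF.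
  by rewrite mxE gtn_eqF ?mul0r // (leq_trans _ da).
rewrite (bigD1 (Ordinal ad)) //= !mxE eqxx mul1r big1 ?addr0 // => i ia.
by rewrite mxE -[a]/(nat_of_ord (Ordinal ad)) eq_sym val_eqE (negPf ia) mul0r.
Qed.

Lemma nat_row_delta n (i : 'I_n) : nat_row n i = delta_mx 0 i.
Proof. by apply/rowP => j; rewrite !mxE eq_sym. Qed.

Lemma row_table_mx (k : 'I_3) i : row i (table_mx k) = nat_row d (step k i).
Proof. by rewrite rowE -nat_row_delta nat_row_mul. Qed.

Lemma table_mx_comm k l : table_mx k *m table_mx l = table_mx l *m table_mx k.
Proof.
by apply/row_matrixP => i; rewrite !row_mul !row_table_mx !nat_row_mul step_comm.
Qed.

Definition table_ker := mx_ker table_mx table_gen.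
Let ev := mx_eval table_mx table_gen.
Let lin := mx_act_linear table_mx.
Let comm := mx_act_comm table_mx_comm.

Lemma eval_word g w : (g < r)%N -> all (fun k => k < 3)%N w ->
  ev (word_vec (g, w)) = nat_row d (word_index (g, w)).
Proof.
move=> gr; elim: w => [_|k w IHw] /=; rewrite /ev /mx_eval.
  rewrite /word_vec /= -[g]/(nat_of_ord (Ordinal gr)).
  have -> : \row_j (nat_of_ord (Ordinal gr) == j)%:R = delta_mx 0 (Ordinal gr) :> 'rV[Poly]_r.
    by apply/rowP => j; rewrite !mxE eq_sym.
  by rewrite gen_eval_delta.
case/andP=> k3 /IHw IH; rewrite /word_vec /= (gen_evalX lin comm) -/(word_vec (g, w)).
by rewrite -/(mx_eval _ _) -/ev IH /mx_act nat_row_mul inordK.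
Qed.

Lemma eval_table_vec i : ev (table_vec i) = delta_mx 0 i.
Proof.
have iwd : (i < size wd)%N by rewrite size_wd.
rewrite /table_vec; have := mem_nth (0%N, [::]) iwd.
case/and5P: ok => _ _ _ _ /allP/(_ (nat_of_ord i)); rewrite mem_iota ltn_ord => /(_ isT).
case: (nth _ _ _) => g w /and4P[/eqP wi gr w3 _] _.
by rewrite eval_word // wi nat_row_delta.
Qed.

Let idx_lt gw : gw \in wd -> (index gw wd < d)%N.
Proof. by rewrite -size_wd index_mem. Qed.

Let table_vecE gw (h : gw \in wd) : table_vec (Ordinal (idx_lt h)) = word_vec gw.
Proof. by rewrite /table_vec /= nth_index. Qed.

Lemma table_gens j : exists i, table_vec i = delta_mx 0 j.
Proof.
exists (Ordinal (idx_lt (gen_wd (ltn_ord j)))); rewrite table_vecE.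
by apply/rowP => k; rewrite !mxE eq_sym.
Qed.

Lemma table_ker_submodule : submodule_pred table_ker.
Proof. exact: mx_ker_submodule table_mx_comm. Qed.

Lemma table_ker_quot_dim : quot_dim_pred table_ker d.
Proof. exact: mx_ker_quot_dim table_mx_comm eval_table_vec. Qed.

Lemma table_kills : all (fun i => step 0 (step 0 i) == d) (iota 0 d) ->
  kills ('X_0 ^+ 2) table_ker.
Proof.
move=> /allP H u; rewrite /table_ker /mx_ker /mx_eval expr2 -scalerA.
rewrite !(gen_evalX lin comm) -/(mx_eval _ _) /mx_act.
rewrite [mx_eval _ _ _]row_sum_delta !mulmx_suml big1 // => i _.
rewrite -!scalemxAl -nat_row_delta !nat_row_mul /=.
have /H/eqP-> : nat_of_ord i \in iota 0 d by rewrite mem_iota ltn_ord.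
by apply/rowP => j; rewrite !mxE gtn_eqF ?mulr0.
Qed.

Let D := def_deriv table_mx table_gen.

(** By the Leibniz rule, lengthening a basis word by [k] adds to the transported derivative exactly
    the corresponding row of [A'_k]; induction on words then trades derivatives for rows. *)
Lemma normal_def_gauge A' : lin_comm table_mx A' ->
  (forall i, D A' (table_vec i) = 0) <->
  (forall g k w (h : (g, w) \in wd), (g, k :: w) \in wd ->
     row (Ordinal (idx_lt h)) (A' (inord k)) = 0).
Proof.
move=> cA'.
have DX g k w (h : (g, w) \in wd) : D A' (word_vec (g, k :: w)) =
    D A' (word_vec (g, w)) *m table_mx (inord k) + row (Ordinal (idx_lt h)) (A' (inord k)).
  have evh := eval_table_vec (Ordinal (idx_lt h)); rewrite /ev table_vecE in evh.
  have -> : word_vec (g, k :: w) = 'X_(inord k) *: word_vec (g, w) by [].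
  by rewrite /D (def_derivX table_gen table_mx_comm cA') evh -rowE.
split=> [D0 g k w h h'|gauge i].
  have := DX g k w h; rewrite -(table_vecE h') -(table_vecE h) !D0 mul0mx add0r.
  by move=> <-.
rewrite /table_vec; have iwd : (i < size wd)%N by rewrite size_wd.
have := mem_nth (0%N, [::]) iwd; case: (nth _ _ _) => g w {i iwd}.
elim: w => [|k w IHw] h.
  have [_ gr _ _] := wdP h; rewrite -(def_deriv_delta table_mx table_gen A' (Ordinal gr)).
  by congr (def_deriv _ _ _ _); apply/rowP => j; rewrite !mxE eq_sym.
have [_ _ _ h'] := wdP h.
by rewrite (DX g k w h') IHw // mul0mx add0r gauge.
Qed.

Local Notation I := ('I_3 * 'I_d * 'I_d)%type.
Local Notation N := #|{: I}|.

Implicit Types u : 'rV[F]_N.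

Definition var_key (n : 'I_N) : var :=
  let: (k, i, a) := enum_val n in (nat_of_ord k, nat_of_ord i, nat_of_ord a).
(** Written as a sum over columns so that an invalid variable automatically has value 0. *)
Definition var_val (u : 'rV[F]_N) (x : var) := \sum_n (var_key n == x)%:R * u 0 n.
Definition unknown_mx (u : 'rV[F]_N) (k : 'I_3) : 'M[F]_d :=
  \matrix_(i, a) u 0 (enum_rank (k, i, a)).

Lemma var_valE u (k : 'I_3) (i a : 'I_d) :
  var_val u (nat_of_ord k, nat_of_ord i, nat_of_ord a) = unknown_mx u k i a.
Proof.
rewrite /var_val mxE (bigD1 (enum_rank (k, i, a))) //= /var_key enum_rankK eqxx mul1r.
rewrite big1 ?addr0 // => n; rewrite -[n in n != _]enum_valK (inj_eq enum_rank_inj).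
case: (enum_val n) => [[k' i'] a'] ne; rewrite -[_ == _]/(((k', i'), a') == ((k, i), a)).
by rewrite (negPf ne) mul0r.
Qed.

Lemma var_key_valid n : valid_var d (var_key n).
Proof. by rewrite /var_key; case: enum_val => [[k i] a]; rewrite /valid_var /= !ltn_ord. Qed.

Lemma valid_varP x : valid_var d x -> exists n, var_key n = x.
Proof.
case: x => [[k i] a] /and3P[/= k3 id ad].
exists (enum_rank (Ordinal k3, Ordinal id, Ordinal ad)).
by rewrite /var_key enum_rankK.
Qed.

Lemma var_val_invalid u x : ~~ valid_var d x -> var_val u x = 0.
Proof.
move=> vx; rewrite /var_val big1 // => n _.
by case: eqP vx => [<-|_]; rewrite ?var_key_valid ?mul0r.
Qed.

Lemma eqn_dot u (e : seq (var * int)) :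
  \sum_n (coef (var_key n) e)%:~R * u 0 n = \sum_(t <- e) t.2%:~R * var_val u t.1.
Proof.
elim: e => [|[x c] e IHe]; first by rewrite big_nil big1 // => n _; rewrite mul0r.
rewrite big_cons -IHe /= /var_val mulr_sumr -big_split; apply: eq_bigr => n _ /=.
by rewrite eq_sym; case: eqP => _; rewrite ?rmorphD /= ?mulrDl ?mul1r ?mul0r ?mulr0 ?add0r.
Qed.

Lemma comm_eqn_dot u (k l : 'I_3) (i j : 'I_d) :
  let A' := unknown_mx u in
  \sum_(t <- comm_eqn d tab k l i j) t.2%:~R * var_val u t.1 =
  (table_mx k *m A' l + A' k *m table_mx l) i j -
  (table_mx l *m A' k + A' l *m table_mx k) i j.
Proof.
move=> A'.
have left_mul (k' l' : 'I_3) :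
    (table_mx k' *m A' l') i j = var_val u (nat_of_ord l', step k' i, nat_of_ord j).
  rewrite mxE; case: (ltnP (step k' i) d) => [lt_d|ge_d]; last first.
    rewrite var_val_invalid ?big1 // => [a _|].
      by rewrite mxE gtn_eqF ?mul0r // (leq_trans _ ge_d).
    by rewrite /valid_var /= (leq_gtF ge_d) andbF.
  rewrite -[step k' i]/(nat_of_ord (Ordinal lt_d)) var_valE.
  rewrite (bigD1 (Ordinal lt_d)) //= !mxE eqxx mul1r big1 ?addr0 // => a ne.
  by rewrite mxE -[step k' i]/(nat_of_ord (Ordinal lt_d)) eq_sym val_eqE (negPf ne) mul0r.
have right_mul (k' l' : 'I_3) : (A' k' *m table_mx l') i j =
    \sum_(a <- [seq a <- iota 0 d | step l' a == j])
       var_val u (nat_of_ord k', nat_of_ord i, a).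
  have -> : iota 0 d = index_iota 0 d by rewrite /index_iota subn0.
  rewrite mxE big_filter big_mkord [RHS]big_mkcond /=.
  apply: eq_bigr => a _; rewrite var_valE [table_mx _ _ _]mxE.
  by case: eqP; rewrite ?mulr1 ?mulr0.
rewrite /comm_eqn big_cat !big_cons !big_map /= [in RHS]mxE [X in _ - X]mxE.
rewrite !left_mul !right_mul mul1r mulN1r opprD; congr (_ + _ + (_ + _)).
  by apply: eq_bigr => a _; rewrite mul1r.
by rewrite -sumrN; apply: eq_bigr => a _; rewrite mulN1r.
Qed.

Lemma tangent_eqnsP u :
  (forall e, e \in tangent_eqns d tab wd -> \sum_n (coef (var_key n) e)%:~R * u 0 n = 0) <->
  normal_def table_mx table_gen table_vec (unknown_mx u).
Proof.
set A' := unknown_mx u.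
have comm_dot (k l : 'I_3) (i j : 'I_d) :
    \sum_n (coef (var_key n) (add_eqn 1
       [seq t <- comm_eqn d tab k l i j | valid_var d t.1] [::]))%:~R * u 0 n =
    (table_mx k *m A' l + A' k *m table_mx l) i j -
    (table_mx l *m A' k + A' l *m table_mx k) i j.
  rewrite -comm_eqn_dot.
  under eq_bigr do rewrite coef_add_eqn mul1r addr0.
  rewrite eqn_dot big_filter big_mkcond; apply: eq_bigr => t _.
  by case: ifPn => // /var_val_invalid->; rewrite mulr0.
have gauge_dot k i a :
    \sum_n (coef (var_key n) [:: ((k, i, a), 1)])%:~R * u 0 n = var_val u (k, i, a).
  by rewrite eqn_dot big_seq1 mul1r.
split=> [eqs|[cA' nA'] e].
  have cA' : lin_comm table_mx A'.
    have H (k l : 'I_3) : (nat_of_ord k, nat_of_ord l) \in [:: (0, 1); (0, 2); (1, 2)]%N ->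
        table_mx k *m A' l + A' k *m table_mx l = table_mx l *m A' k + A' l *m table_mx k.
      move=> kl; apply/matrixP => i j; apply/eqP; rewrite -subr_eq0 -comm_dot; apply/eqP.
      apply: eqs; rewrite mem_cat; apply/orP; right; apply/allpairsP.
      exists ((nat_of_ord k, nat_of_ord l), (nat_of_ord i, nat_of_ord j)); split=> //.
      by apply: allpairs_f; rewrite mem_iota ltn_ord.
    move=> k l; case: (ltngtP k l) => [kl|lk|/val_inj-> //]; last first.
      apply/esym/H; case: k l lk => [[|[|[|]]] //= ?] [[|[|[|]]] //= ?] //.
    by apply: H; case: k l kl => [[|[|[|]]] //= ?] [[|[|[|]]] //= ?].
  split=> //; apply/normal_def_gauge => // g k w h h'; apply/rowP => a.
  have [_ _ /andP[k3 _] _] := wdP h'.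
  rewrite mxE [RHS]mxE /A' -var_valE inordK // -gauge_dot; apply: eqs.
  rewrite mem_cat; apply/orP; left; apply/flattenP.
  exists [seq [:: ((k, index (g, w) wd, a'), 1)] | a' <- iota 0 d].
    by apply/mapP; exists (g, k :: w).
  by apply/mapP; exists (nat_of_ord a); rewrite // mem_iota ltn_ord.
rewrite mem_cat => /orP[/flattenP[s /mapP[[g [|k w]] h ->]] // /mapP[a]|].
  rewrite mem_iota => /andP[_ ad] ->; rewrite gauge_dot.
  have [_ _ /andP[k3 _] h'] := wdP h.
  have /rowP/(_ (Ordinal ad)) := (normal_def_gauge cA').1 nA' g k w h' h.
  by rewrite mxE [RHS]mxE /A' -var_valE inordK.
case/allpairsP => -[kl ij] [/= kl3 /allpairsP[[i j] [/=]]].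
rewrite !mem_iota => /andP[_ id] /andP[_ jd] -> ->.
have /andP[k3 l3] : (kl.1 < 3)%N && (kl.2 < 3)%N.
  by move: kl3; rewrite !inE => /or3P[] /eqP->.
have := comm_dot (Ordinal k3) (Ordinal l3) (Ordinal id) (Ordinal jd).
by rewrite /= => ->; rewrite cA' subrr.
Qed.

Lemma unknown_mx_sum n (c : 'I_n -> F) (B : 'M[F]_(n, N)) k :
  unknown_mx (\row_i c i *m B) k = \sum_i c i *: unknown_mx (row i B) k.
Proof.
apply/matrixP => i a; rewrite mxE mulmx_sum_row !summxE.
by apply: eq_bigr => j _; rewrite !mxE.
Qed.

(** The three [d] by [d] matrices have [3 * d * d] entries, and a basis of the solution space of the
    system supplies the basis of normalised deformations. *)
Lemma table_ker_hom_dim k : table_rank d tab wd = Some k ->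
  hom_dim_pred table_ker (3 * d * d - k).
Proof.
move=> /(elim_rank_ker F valid_varP); set C := kermx _.
have -> : (3 * d * d)%N = N by rewrite !card_prod !card_ord.
move=> <-.
have solP u : (u <= C)%MS <-> normal_def table_mx table_gen table_vec (unknown_mx u).
  by rewrite -tangent_eqnsP; split=> /eqns_kerP.
apply: (mx_ker_hom_dim table_mx_comm eval_table_vec table_gens
  (t := fun i => unknown_mx (row i (row_base C)))).
  by move=> i; apply/solP; rewrite -(eq_row_base C) row_sub.
move=> A' nA'; pose u : 'rV[F]_N := \row_n
  let: (k, i, a) := enum_val n in A' k i a.
have A'u k' : unknown_mx u k' = A' k' by apply/matrixP => i a; rewrite !mxE enum_rankK.
have nu : normal_def table_mx table_gen table_vec (unknown_mx u).
  by apply: (normal_def_ext table_mx_comm _ nA') => k'; rewrite A'u.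
have /submxP[c uc] : (u <= row_base C)%MS by rewrite eq_row_base; apply/solP.
exists [ffun i => c 0 i]; split=> [k'|c' c'E].
  rewrite -unknown_mx_sum -A'u uc; congr (unknown_mx (_ *m _) _).
  by apply/rowP => i; rewrite mxE ffunE.
apply/ffunP => i; rewrite ffunE.
suff -> : c = \row_i c' i by rewrite mxE.
apply: (row_free_inj (row_base_free C)); rewrite -uc.
apply/rowP => n; rewrite mxE -(enum_valK n) enum_rankK.
case: (enum_val n) => [[k' i'] a']; rewrite c'E -unknown_mx_sum mxE.
by [].
Qed.
End Table.

(** * Families and the two basic points *)

Section Families.
Context (F : numFieldType).
Local Notation Poly := {mpoly F[3]}.

Definition quot_point r (K : 'rV[Poly]_r -> Prop) d n :=
  [/\ submodule_pred K, quot_dim_pred K d & hom_dim_pred K n].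

Lemma quot_point_add_free r (K : 'rV[Poly]_r -> Prop) d n :
  quot_point K d n -> quot_point (add_free K) d (n + d).
Proof.
move=> [sK qK hK]; split; first exact: add_free_submodule.
  exact: add_free_quot_dim.
exact: add_free_hom_dim.
Qed.

Lemma quot_point_meet r (K P : 'rV[Poly]_r -> Prop) f d1 d2 n1 n2 :
  kills f K -> kills (1 - f) P -> quot_point K d1 n1 -> quot_point P d2 n2 ->
  quot_point (meet_pred K P) (d1 + d2) (n1 + n2).
Proof.
move=> fK fP [sK qK hK] [sP qP hP]; split; first exact: meet_submodule.
  exact: meet_quot_dim sK sP fK fP _ _ qK qP.
exact: meet_hom_dim sK sP fK fP _ _ hK hP.
Qed.

(** * Reduced points on the first coordinate axis *)

Definition axis_pt (a : F) (k : 'I_3) : F := if k == 0 then a else 0.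

Lemma poly_act_scalar (V : lmodType F) (T : 'I_3 -> V -> V) s (p : Poly) v :
  (forall k w, T k w = s k *: w) -> poly_act T p v = p.@[s] *: v.
Proof.
move=> Ts; pose G (q : Poly^o) := q.@[s] *: v.
have -> : v = G 1 by rewrite /G meval1 scale1r.
rewrite -(equivariant_poly_act (T := T) (G := G)) ?meval1.
- by rewrite /G [p *: _]mulr1 meval1 scale1r.
- by move=> x y; rewrite /G mevalD scalerDl.
- by move=> c x; rewrite /G [_ *: x]mul_mpolyC mevalZ scalerA.
- by move=> k x; rewrite /G Ts mevalM mevalXU scalerA.
Qed.

(** Matrices of size 1 commute, so every triple of them is a normalised deformation; this gives
    tangent dimension 3. *)
Lemma reduced_point a : exists2 P : 'rV[Poly]_1 -> Prop,
  quot_point P 1 3 & forall q, q.@[axis_pt a] = 0 -> kills q P.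
Proof.
pose A (k : 'I_3) : 'M[F]_1 := (axis_pt a k)%:M.
pose e (j : 'I_1) : 'rV[F]_1 := delta_mx 0 j.
pose b (i : 'I_1) : 'rV[Poly]_1 := delta_mx 0 i.
have commA k l : A k *m A l = A l *m A k by rewrite scalar_mxC.
have evb i : mx_eval A e (b i) = delta_mx 0 i by rewrite /mx_eval gen_eval_delta.
have gens j : exists i, b i = delta_mx 0 j by exists j.
have normal A' : normal_def A e b A'.
  split=> [k l|i]; last exact: def_deriv_delta.
  by rewrite addrC [A' k *m _]scalar_mxC [A' l *m _]scalar_mxC.
exists (mx_ker A e); last first.
  move=> q q0 u; rewrite /mx_ker /mx_eval.
  rewrite (gen_evalZ (mx_act_linear A) (mx_act_comm commA)).
  rewrite (poly_act_scalar (s := axis_pt a)) ?q0 ?scale0r // => k w.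
  by rewrite /mx_act /A mul_mx_scalar.
split; [exact: mx_ker_submodule | exact: mx_ker_quot_dim evb|].
apply: (mx_ker_hom_dim commA evb gens (t := fun i k => (i == k)%:R%:M)) => // A' _.
have sumE (c : 'I_3 -> F) k : \sum_i c i *: (i == k)%:R%:M = (c k)%:M :> 'M_1.
  rewrite (bigD1 k) //= eqxx big1 ?addr0 ?scalemx1 // => i /negPf->.
  by rewrite raddf0 scaler0.
exists [ffun k => A' k 0 0]; split=> [k|c cE].
  by rewrite sumE ffunE -mx11_scalar.
by apply/ffunP => k; rewrite ffunE cE sumE mxE eqxx.
Qed.

Lemma reduced_point_rank r a : exists2 P : 'rV[Poly]_r.+1 -> Prop,
  quot_point P 1 (r + 3) & forall q, q.@[axis_pt a] = 0 -> kills q P.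
Proof.
elim: r => [|r [P PP kP]]; first exact: reduced_point.
exists (add_free P); first by have := quot_point_add_free PP; rewrite addn1.
by move=> q /kP qP; apply: add_free_kills.
Qed.

(** The parameter [t] counts the axis points already used: [f] annihilates the current quotient and
    is nonzero at all later points. The rank is [r.+1], so each point adds [r + 3]. *)
Lemma quot_point_add_points m r (K : 'rV[Poly]_r.+1 -> Prop) f d n t :
  quot_point K d n -> kills f K ->
  (forall s, (t <= s)%N -> f.@[axis_pt s.+1%:R] != 0) ->
  exists K' : 'rV[Poly]_r.+1 -> Prop, quot_point K' (d + m) (n + m * (r + 3)).
Proof.
elim: m K f d n t => [|m IHm] K f d n t KP fK f0; first by exists K; rewrite !addn0.
pose x := axis_pt t.+1%:R; have [P PP kP] := reduced_point_rank r t.+1%:R.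
have sK : submodule_pred K by case: KP.
(* Rescaling to value 1 at [x] makes [1 - g] vanish there and so annihilate the new point. *)
pose g := (f.@[x])^-1 *: f.
have gK : kills g K by move=> u; rewrite /g -mul_mpolyC -scalerA; apply: submodZ.
have gP : kills (1 - g) P.
  by apply: kP; rewrite mevalB meval1 mevalZ mulVf ?subrr // f0.
have -> : (d + m.+1 = d + 1 + m)%N by rewrite addnAC addn1 addnS.
have -> : (n + m.+1 * (r + 3) = n + (r + 3) + m * (r + 3))%N by rewrite mulSn addnA.
(* The new factor vanishes at the point just added, and at no later point of the axis. *)
apply: (IHm _ (f * ('X_0 - t.+1%:R%:MP)) _ _ t.+1 (quot_point_meet gK gP KP PP)).
- move=> u; split; first by rewrite -scalerA; apply: fK.
  by apply: kP; rewrite mevalM mevalB mevalXU mevalC /axis_pt eqxx subrr mulr0.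
- move=> s ts; rewrite mevalM mevalB mevalXU mevalC /axis_pt eqxx mulf_neq0 //.
    by rewrite f0 // ltnW.
  by rewrite subr_eq0 eqr_nat eqSS gtn_eqF.
Qed.

Lemma quot_point_add_gens q r (K : 'rV[Poly]_r -> Prop) f d n :
  quot_point K d n -> kills f K ->
  exists2 K' : 'rV[Poly]_(q + r) -> Prop, quot_point K' d (n + q * d) & kills f K'.
Proof.
move=> KP fK; elim: q => [|q [K' KP' fK']]; first by exists K; rewrite ?addn0.
exists (add_free K'); last exact: add_free_kills.
have -> : (n + q.+1 * d = n + q * d + d)%N by rewrite mulSn addnA addnAC.
exact: quot_point_add_free.
Qed.

Lemma quot_point_table d tab wd r k q m : (0 < r)%N -> table_ok d tab wd r ->
  all (fun i => step d tab 0 (step d tab 0 i) == d) (iota 0 d) ->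
  table_rank d tab wd = Some k ->
  exists K : 'rV[Poly]_(q + r) -> Prop,
    quot_point K (d + m) (3 * d * d - k + q * d + m * ((q + r).-1 + 3)).
Proof.
case: r => // r _ ok nil rk; have xK := table_kills (F := F) ok nil.
have KP : quot_point (@table_ker F d r.+1 tab wd) d (3 * d * d - k).
  split; [exact: table_ker_submodule | exact: table_ker_quot_dim | exact: table_ker_hom_dim].
have [K' KP' fK'] := quot_point_add_gens q KP xK.
move: K' KP' fK'; rewrite addnS => K' KP' fK'.
(* The square of the first variable annihilates the table module and is nonzero at every point
   [s.+1] of the axis, so the count starts at 0. *)
apply: (quot_point_add_points m (t := 0) KP' fK') => s _.
by rewrite expr2 mevalM mevalXU /axis_pt eqxx mulf_neq0 // pnatr_eq0.
Qed.

End Families.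

(* The algebra [R / (x^2, x (y, z)^2, (y, z)^4, y^3 - x z)], on the basis
   1, x, y, z, y^2, yz, z^2, xy, xz, y^2 z, y z^2, z^3. *)
Definition alg12_table : seq (seq nat) :=
  [:: [:: 1; 12; 7; 8]; [:: 2; 7; 4; 5; 8; 9; 10]; [:: 3; 8; 5; 6; 9; 10; 11]]%N.
Definition alg12_words : seq (nat * seq nat) :=
  [:: (0, [::]); (0, [:: 0]); (0, [:: 1]); (0, [:: 2]); (0, [:: 1; 1]);
      (0, [:: 2; 1]); (0, [:: 2; 2]); (0, [:: 1; 0]); (0, [:: 2; 0]);
      (0, [:: 2; 1; 1]); (0, [:: 2; 2; 1]); (0, [:: 2; 2; 2])]%N.

(* The module generated by [e] and [f] with [x f = 0], [y f = z^2 e] and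
   [z f = x e], on the basis e, f, x e, y e, z e, y^2 e, yz e, z^2 e. *)
Definition mod8_table : seq (seq nat) :=
  [:: [:: 2]; [:: 3; 7; 8; 5; 6]; [:: 4; 2; 8; 6; 7]]%N.
Definition mod8_words : seq (nat * seq nat) :=
  [:: (0, [::]); (1, [::]); (0, [:: 0]); (0, [:: 1]); (0, [:: 2]);
      (0, [:: 1; 1]); (0, [:: 2; 1]); (0, [:: 2; 2])]%N.

(** There are 432 unknowns, so 45 remain free, while [r * d = 12] is even. *)
Lemma alg12_rank : table_rank 12 alg12_table alg12_words = Some 387%N.
Proof. by vm_compute. Qed.

(** There are 192 unknowns, so 39 remain free, while [r * d = 16] is even. *)
Lemma mod8_rank : table_rank 8 mod8_table mod8_words = Some 153%N.
Proof. by vm_compute. Qed.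

Theorem theoremA (r d : nat) :
  (r = 1%N /\ (12 <= d)%N) \/ ((2 <= r)%N /\ (8 <= d)%N) ->
  exists K : 'rV[{mpoly CC[3]}]_r -> Prop,
    [/\ is_submodule K, quot_dim K d &
        exists n : nat, hom_dim K n /\ odd n != odd (r * d)].
Proof.
case=> [[-> d12] | [r2 d8]].
- have [K [sK qK hK]] := @quot_point_table CC 12 _ _ 1 _ 0 (d - 12) isT
    (isT : table_ok 12 alg12_table alg12_words 1) isT alg12_rank.
  rewrite subnKC // in qK; exists K; split=> //; eexists; split; first exact: hK.
  (* The dimension is [45 + 3 * (d - 12)], of parity opposite to [d]. *)
  by rewrite mul1n oddD oddM oddB //; case: (odd d).
- rewrite -(subnK r2); move: (r - 2)%N => q {r r2}.
  have [K [sK qK hK]] := @quot_point_table CC 8 _ _ 2 _ q (d - 8) isT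
    (isT : table_ok 8 mod8_table mod8_words 2) isT mod8_rank.
  rewrite subnKC // in qK; exists K; split=> //; eexists; split; first exact: hK.
  (* The dimension is [39 + 8 * q + (d - 8) * (q + 4)], of the parity of [1 + d * q], to be compared
     with [(q + 2) * d]. *)
  have -> : ((q + 2).-1 + 3 = q + 4)%N by rewrite addn2 addSnnS.
  by rewrite !(oddD, oddM) [odd (d - 8)]oddB //; case: (odd d); case: (odd q).
Qed.
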